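(* Assume $0<\sigma_1<\sigma_2$ and fix $y\in(0,1]$, with $\theta(y)\in\mathbb{R}$ as in the context. Let $(x_1^*(y),x_2^*(y))$, with $x_2^*(y)>x_1^*(y)$, be the unique such solution in $(\theta(y),+\infty)\times(\theta(y),+\infty)$ of the system $F_1(x_1^*(y),x_2^*(y);y)=0$, $F_2(x_1^*(y),x_2^*(y);y)=0$ (with $F_1,F_2$ defined in the context). Define $$A_3(y)=\frac{\alpha_4(x_1^*(y)-\theta(y))-1}{\alpha_4-\alpha_3}e^{-\alpha_3x_1^*(y)},\qquad A_4(y)=\frac{1-\alpha_3(x_1^*(y)-\theta(y))}{\alpha_4-\alpha_3}e^{-\alpha_4x_1^*(y)},$$ $B_3(y)=\frac{\Phi_1(\alpha_3)}{\lambda_1}A_3(y)$, $B_4(y)=\frac{\Phi_1(\alpha_4)}{\lambda_1}A_4(y)$, and $$B_5(y)=\frac{\rho}{\rho+\lambda_2}\,\frac{e^{-\alpha_5x_2^*(y)}\big(1+\alpha_5(x_2^*(y)-\theta(y))\big)}{2\alpha_5},\qquad B_6(y)=\frac{\rho}{\rho+\lambda_2}\,\frac{e^{\alpha_5x_2^*(y)}\big(\alpha_5(x_2^*(y)-\theta(y))-1\big)}{2\alpha_5}.$$ Then the functions $$w(x,1;y):=\begin{cases}A_3(y)e^{\alpha_3x}+A_4(y)e^{\alpha_4x},&x\le x_1^*(y)\\ x-\theta(y),&x\ge x_1^*(y),\end{cases}$$ $$w(x,2;y):=\begin{cases}B_3(y)e^{\alpha_3x}+B_4(y)e^{\alpha_4x},&x\le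 x_1^*(y)\\ B_5(y)e^{\alpha_5x}+B_6(y)e^{-\alpha_5x}+\lambda_2\frac{x-\theta(y)}{\rho+\lambda_2},&x_1^*(y)\le x\le x_2^*(y)\\ x-\theta(y),&x\ge x_2^*(y)\end{cases}$$ are such that $w(\cdot,i;y)\in C^1(\mathbb{R})$ with $w_{xx}(\cdot,i;y)\in L^\infty_{loc}(\mathbb{R})$ for $i=1,2$, and $|w(x,i;y)|\le\kappa_i(y)(1+|x|)$ for some $\kappa_i(y)>0$. Moreover $(w(\cdot,1;y),w(\cdot,2;y),x_1^*(y),x_2^*(y))$ solves the free-boundary problem: (a) $\frac12\sigma_i^2w_{xx}(x,i;y)-\rho w(x,i;y)+\lambda_i(w(x,3-i;y)-w(x,i;y))=0$ for $x<x_1^*(y)$ and $i=1,2$, and for $x_1^*(y)<x<x_2^*(y)$ and $i=2$; (b) $w(x,1;y)=x-\theta(y)$ for $x_1^*(y)\le x\le x_2^*(y)$, and $w(x,1;y)=x-\theta(y)=w(x,2;y)$ for $x\ge x_2^*(y)$; (c) $\frac12\sigma_i^2w_{xx}(x,i;y)-\rho w(x,i;y)+\lambda_i(w(x,3-i;y)-w(x,i;y))\le0$ for a.e. $x\in\mathbb{R}$ and $i=1,2$, and $w(x,i;y)\ge x-\theta(y)$ for all $x\in\mathbb{R}$ and $i=1,2$.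
   Context: Constants: $\rho,\lambda_1,\lambda_2,\sigma_1,\sigma_2,c>0$. $f:\mathbb{R}\to\mathbb{R}_+$ is increasing, continuous on $[0,1]$, $f(0)=0$, and either (I) $f$ is strictly convex and $C^1$ on $[0,1]$, in which case $\theta(y)=c-f'(y)/\rho$, or (II) $f$ is concave on $[0,1]$ and $C^1$ on $(0,1]$, in which case $\theta(y)=c-\frac{f(y)}{\rho y}$. (For the statement, $\theta(y)$ only plays the role of a given real constant.) $\Phi_i(\alpha)=-\frac12\sigma_i^2\alpha^2+\rho+\lambda_i$, $i=1,2$; $0<\alpha_3<\alpha_4$ are the two positive roots of $\Phi_1(\alpha)\Phi_2(\alpha)-\lambda_1\lambda_2=0$ (the other two roots are negative); $\alpha_5=\sqrt{2(\rho+\lambda_2)/\sigma_2^2}$; $$a_1=-\frac{\alpha_4\Phi_1(\alpha_3)-\alpha_3\Phi_1(\alpha_4)}{\lambda_1(\alpha_4-\alpha_3)}+\frac{\lambda_2}{\rho+\lambda_2},\quad a_2=\frac{\Phi_1(\alpha_3)-\Phi_1(\alpha_4)}{\lambda_1(\alpha_4-\alpha_3)},$$ $$a_3=\frac{\alpha_3\alpha_4[\Phi_1(\alpha_4)-\Phi_1(\alpha_3)]}{\lambda_1(\alpha_4-\alpha_3)},\quad a_4=\frac{\alpha_3\Phi_1(\alpha_3)-\alpha_4\Phi_1(\alpha_4)}{\lambda_1(\alpha_4-\alpha_3)}+\frac{\lambda_2}{\rho+\lambda_2};$$ $$F_1(u,v;y)=\tfrac{\rho}{\rho+\lambda_2}\Big[(v-\theta(y))\cosh(\alpha_5(v-u))-\tfrac1{\alpha_5}\sinh(\alpha_5(v-u))\Big]+a_1(u-\theta(y))+a_2,$$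 $$F_2(u,v;y)=\tfrac{\rho}{\rho+\lambda_2}\Big[\cosh(\alpha_5(v-u))-\alpha_5(v-\theta(y))\sinh(\alpha_5(v-u))\Big]+a_3(u-\theta(y))+a_4.$$ When $\sigma_1<\sigma_2$ there is exactly one couple $(x_1^*(y),x_2^*(y))$ with $\theta(y)<x_1^*(y)<x_2^*(y)$ solving $F_1=F_2=0$. *)

(* Defs.v *)
From HB Require Import structures.
From mathcomp Require Import all_boot all_order all_algebra.
From mathcomp Require Import all_classical all_reals all_analysis.
Set Implicit Arguments.
Unset Strict Implicit.
Unset Printing Implicit Defensive.
Import Order.TTheory GRing.Theory Num.Theory.
Import numFieldNormedType.Exports.
Local Open Scope classical_set_scope.
Local Open Scope ring_scope.

(* Derivative of f at z along the set D: two-sided at interior points of D,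
   one-sided at the endpoints when D is an interval. *)
Definition difference_quotient_on (R : realType) (D : set R) (f : R -> R)
    (z : R) : set_system R :=
  (f t - f z) / (t - z) @[t --> within (D `\ z) (nbhs z)].

Definition derive_on (R : realType) (D : set R) (f : R -> R) (z : R) : R :=
  lim (difference_quotient_on D f z).

Definition C1_on (R : realType) (D : set R) (f : R -> R) : Prop :=
  (forall z, D z -> cvg (difference_quotient_on D f z)) /\
  {within D, continuous (derive_on D f)}.

Definition strictly_convex_on (R : realType) (D : set R) (f : R -> R) : Prop :=
  forall a b t, D a -> D b -> a != b -> 0 < t < 1 ->
    f (t * a + (1 - t) * b) < t * f a + (1 - t) * f b.

Definition concave_on (R : realType) (D : set R) (f : R -> R) : Prop :=
  forall a b t, D a -> D b -> 0 <= t <= 1 ->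
    t * f a + (1 - t) * f b <= f (t * a + (1 - t) * b).

Definition cost_function (R : realType) (f : R -> R) : Prop :=
  [/\ forall x, 0 <= f x, {homo f : x z / x <= z},
      {within `[0, 1], continuous f} & f 0 = 0].

(* th is the value theta(y).  The two cases exclude each other, since a
   strictly convex function on [0, 1] is not concave there. *)
Definition is_theta (R : realType) (rho c : R) (f : R -> R) (y th : R) : Prop :=
  [/\ strictly_convex_on `[0, 1] f, C1_on `[0, 1] f &
      th = c - derive_on `[0, 1] f y / rho] \/
  [/\ concave_on `[0, 1] f, C1_on `]0, 1] f & th = c - f y / (rho * y)].

Definition cosh (R : realType) (x : R) : R := (expR x + expR (- x)) / 2.
Definition sinh (R : realType) (x : R) : R := (expR x - expR (- x)) / 2.

Record model (R : realType) := Model {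
  rho : R;
  lambda1 : R; lambda2 : R;
  sigma1 : R; sigma2 : R
}.

Definition Phi1 (R : realType) (M : model R) (al : R) : R :=
  - (2^-1 * sigma1 M ^+ 2 * al ^+ 2) + rho M + lambda1 M.
Definition Phi2 (R : realType) (M : model R) (al : R) : R :=
  - (2^-1 * sigma2 M ^+ 2 * al ^+ 2) + rho M + lambda2 M.

Definition is_char_root (R : realType) (M : model R) (al : R) : Prop :=
  Phi1 M al * Phi2 M al - lambda1 M * lambda2 M = 0.

Definition alpha5 (R : realType) (M : model R) : R :=
  Num.sqrt (2 * (rho M + lambda2 M) / sigma2 M ^+ 2).

(* In the definitions below, al3 and al4 stand for the positive roots
   alpha_3 < alpha_4 and th for theta(y). *)
Definition a1 (R : realType) (M : model R) (al3 al4 : R) : R :=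
  - ((al4 * Phi1 M al3 - al3 * Phi1 M al4) / (lambda1 M * (al4 - al3)))
  + lambda2 M / (rho M + lambda2 M).
Definition a2 (R : realType) (M : model R) (al3 al4 : R) : R :=
  (Phi1 M al3 - Phi1 M al4) / (lambda1 M * (al4 - al3)).
Definition a3 (R : realType) (M : model R) (al3 al4 : R) : R :=
  al3 * al4 * (Phi1 M al4 - Phi1 M al3) / (lambda1 M * (al4 - al3)).
Definition a4 (R : realType) (M : model R) (al3 al4 : R) : R :=
  (al3 * Phi1 M al3 - al4 * Phi1 M al4) / (lambda1 M * (al4 - al3))
  + lambda2 M / (rho M + lambda2 M).

Definition F1 (R : realType) (M : model R) (al3 al4 th u v : R) : R :=
  rho M / (rho M + lambda2 M) *
    ((v - th) * cosh (alpha5 M * (v - u))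
     - (alpha5 M)^-1 * sinh (alpha5 M * (v - u)))
  + a1 M al3 al4 * (u - th) + a2 M al3 al4.
Definition F2 (R : realType) (M : model R) (al3 al4 th u v : R) : R :=
  rho M / (rho M + lambda2 M) *
    (cosh (alpha5 M * (v - u))
     - alpha5 M * (v - th) * sinh (alpha5 M * (v - u)))
  + a3 M al3 al4 * (u - th) + a4 M al3 al4.

Definition A3 (R : realType) (al3 al4 th x1 : R) : R :=
  (al4 * (x1 - th) - 1) / (al4 - al3) * expR (- (al3 * x1)).
Definition A4 (R : realType) (al3 al4 th x1 : R) : R :=
  (1 - al3 * (x1 - th)) / (al4 - al3) * expR (- (al4 * x1)).
Definition B3 (R : realType) (M : model R) (al3 al4 th x1 : R) : R :=
  Phi1 M al3 / lambda1 M * A3 al3 al4 th x1.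
Definition B4 (R : realType) (M : model R) (al3 al4 th x1 : R) : R :=
  Phi1 M al4 / lambda1 M * A4 al3 al4 th x1.
Definition B5 (R : realType) (M : model R) (th x2 : R) : R :=
  rho M / (rho M + lambda2 M) *
    (expR (- (alpha5 M * x2)) * (1 + alpha5 M * (x2 - th)) / (2 * alpha5 M)).
Definition B6 (R : realType) (M : model R) (th x2 : R) : R :=
  rho M / (rho M + lambda2 M) *
    (expR (alpha5 M * x2) * (alpha5 M * (x2 - th) - 1) / (2 * alpha5 M)).

(* At x1 and x2 the formula of the branch to the left is used; adjacent
   branches agree there whenever the resulting function is continuous. *)
Definition w1 (R : realType) (al3 al4 th x1 x : R) : R :=
  if x <= x1 then
    A3 al3 al4 th x1 * expR (al3 * x) + A4 al3 al4 th x1 * expR (al4 * x)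
  else x - th.
Definition w2 (R : realType) (M : model R) (al3 al4 th x1 x2 x : R) : R :=
  if x <= x1 then
    B3 M al3 al4 th x1 * expR (al3 * x) + B4 M al3 al4 th x1 * expR (al4 * x)
  else if x <= x2 then
    B5 M th x2 * expR (alpha5 M * x) + B6 M th x2 * expR (- (alpha5 M * x))
    + lambda2 M * ((x - th) / (rho M + lambda2 M))
  else x - th.

Definition C1 (R : realType) (w : R -> R) : Prop :=
  (forall x, derivable w x 1) /\ continuous (derive1 w).

Definition test_function (R : realType) (phi : R -> R) : Prop :=
  (forall (n : nat) (x : R), derivable (derive1n n phi) x 1) /\
  compact (closure [set x | phi x != 0]).

Definition is_weak_derivative (R : realType) (u g : R -> R) : Prop :=
  [/\ locally_integrable [set: R] u, locally_integrable [set: R] g &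
      forall phi, test_function phi ->
        \int[@lebesgue_measure R]_x (u x * derive1 phi x) =
        - \int[@lebesgue_measure R]_x (g x * phi x)].

Definition Linfty_loc (R : realType) (g : R -> R) : Prop :=
  measurable_fun [set: R] g /\
  forall K : set R, compact K ->
    finite_norm (@lebesgue_measure R) +oo%E (g \_ K).

(* w_xx in L^oo_loc.  The pointwise second derivative (a junk value at points
   where it does not exist) is required to represent the distributional one,
   so that the a.e. statements about derive1n 2 below concern w_xx. *)
Definition second_derivative_Linfty_loc (R : realType) (w : R -> R) : Prop :=
  is_weak_derivative (derive1 w) (derive1n 2 w) /\ Linfty_loc (derive1n 2 w).

Definition twice_derivable_at (R : realType) (w : R -> R) (x : R) : Prop :=
  (\forall z \near x, derivable w z 1) /\ derivable (derive1 w) x 1.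

Definition linear_growth (R : realType) (w : R -> R) : Prop :=
  exists2 kappa : R, 0 < kappa & forall x, `|w x| <= kappa * (1 + `|x|).

Definition generator (R : realType) (rho lambda sigma : R) (u v : R -> R)
    (x : R) : R :=
  2^-1 * sigma ^+ 2 * derive1n 2 u x - rho * u x + lambda * (v x - u x).

Definition pde_at (R : realType) (rho lambda sigma : R) (u v : R -> R)
    (x : R) : Prop :=
  twice_derivable_at u x /\ generator rho lambda sigma u v x = 0.

Definition pde_ineq_ae (R : realType) (rho lambda sigma : R) (u v : R -> R)
    : Prop :=
  {ae @lebesgue_measure R, forall x : R,
     twice_derivable_at u x /\ generator rho lambda sigma u v x <= 0}.

Definition fbp_a (R : realType) (M : model R) (u1 u2 : R -> R) (x1 x2 : R) :=
  [/\ forall x, x < x1 -> pde_at (rho M) (lambda1 M) (sigma1 M) u1 u2 x,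
      forall x, x < x1 -> pde_at (rho M) (lambda2 M) (sigma2 M) u2 u1 x &
      forall x, x1 < x < x2 ->
        pde_at (rho M) (lambda2 M) (sigma2 M) u2 u1 x].

Definition fbp_b (R : realType) (th : R) (u1 u2 : R -> R) (x1 x2 : R) :=
  (forall x, x1 <= x <= x2 -> u1 x = x - th) /\
  (forall x, x2 <= x -> u1 x = x - th /\ u2 x = x - th).

Definition fbp_c (R : realType) (M : model R) (th : R) (u1 u2 : R -> R) :=
  [/\ pde_ineq_ae (rho M) (lambda1 M) (sigma1 M) u1 u2,
      pde_ineq_ae (rho M) (lambda2 M) (sigma2 M) u2 u1,
      forall x, x - th <= u1 x &
      forall x, x - th <= u2 x].

Definition free_boundary_problem (R : realType) (M : model R) (th : R)
    (u1 u2 : R -> R) (x1 x2 : R) : Prop :=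
  [/\ fbp_a M u1 u2 x1 x2, fbp_b th u1 u2 x1 x2 & fbp_c M th u1 u2].

(* Main.v *)
(* All branches are of the form a e^(kx) + b e^(lx) + mx + n.  The smooth fit of
   w(.,1) at x1 and of w(.,2) at x2 holds by the choice of coefficients, and
   F1 = F2 = 0 is the smooth fit of w(.,2) at x1.  On [x1, x2], hyperbolic
   inequalities give w(x,2) >= x - theta, w_x(x,2) <= 1 and convexity of w(.,2),
   whatever x1 is.  The bound w_x(x1,2) <= 1, read through the left branch,
   forces alpha3 alpha4 (x1 - theta) <= alpha3 + alpha4, i.e. w_xx(x1-,1) >= 0;
   this yields the obstacle inequality for w(.,1) and the supersolution property
   of w(.,1) on (x1, x2).  On (-oo, x1], w(.,2) is convex, because w_xx(.,2) is
   continuous at x1, and tangent to a line lying above x - theta. *)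
Require Import Defs.
From HB Require Import structures.
From mathcomp Require Import all_boot all_order all_algebra.
From mathcomp Require Import all_classical all_reals all_analysis.
From mathcomp Require Import measurable_realfun ess_sup_inf ring lra.
Import Order.TTheory GRing.Theory Num.Theory.
Import numFieldNormedType.Exports.
Local Open Scope classical_set_scope.
Local Open Scope ring_scope.

(** * Gluing two functions at a point *)

Definition glue {R : realType} (p : R) (f g : R -> R) (x : R) : R :=
  if x <= p then f x else g x.

Lemma glueL {R : realType} (p : R) (f g : R -> R) (x : R) :
  x <= p -> glue p f g x = f x.
Proof. by rewrite /glue => ->. Qed.

Lemma glueR {R : realType} (p : R) (f g : R -> R) (x : R) :
  p < x -> glue p f g x = g x.
Proof. by rewrite /glue ltNge => /negbTE ->. Qed.

Lemma continuous_glue {R : realType} (p : R) (f g : R -> R) :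
  continuous f -> continuous g -> f p = g p -> continuous (glue p f g).
Proof.
move=> cf cg fgp x; have [xp|px|->] := ltgtP x p.
- have nfg : \near x, f x = glue p f g x.
    by near=> z; rewrite /glue ifT//; apply/ltW; near: z; exact: lt_nbhsl.
  move: (cf x); rewrite /continuous_at (nbhs_singleton nfg); apply: cvg_trans.
  exact: near_eq_cvg.
- have nfg : \near x, g x = glue p f g x.
    by near=> z; rewrite /glue ifF//; apply/negbTE; rewrite -ltNge; near: z;
    exact: lt_nbhsr.
  move: (cg x); rewrite /continuous_at (nbhs_singleton nfg); apply: cvg_trans.
  exact: near_eq_cvg.
- apply/cvgrPdist_lt => e e0; near=> z.
  rewrite {1}/glue lexx /glue; case: ifP => _; last rewrite fgp.
    by near: z; apply: cvgr_dist_lt => //; exact: cf.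
  by near: z; apply: cvgr_dist_lt => //; exact: cg.
Unshelve. all: by end_near. Qed.

Lemma is_derive_glue_neq {R : realType} (p x : R) (f g df dg : R -> R) :
  x != p -> is_derive x 1 f (df x) -> is_derive x 1 g (dg x) ->
  is_derive x 1 (glue p f g) (glue p df dg x).
Proof.
rewrite neq_lt => /orP[xp dfx _|px _ dgx].
  rewrite [glue p df dg x]/glue ifT ?ltW//.
  apply: near_eq_is_derive dfx.
  by near=> z; rewrite /glue ifT//; apply/ltW; near: z; exact: lt_nbhsl.
rewrite [glue p df dg x]/glue ifF; last by apply/negbTE; rewrite -ltNge.
apply: near_eq_is_derive dgx.
by near=> z; rewrite /glue ifF//; apply/negbTE; rewrite -ltNge; near: z;
    exact: lt_nbhsr.
Unshelve. all: by end_near. Qed.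

(** At [p] the difference quotient of the glued function is that of [f] or that of [g], according to
    the sign of the increment. Agreement of values and slopes gives both the same limit. *)
Lemma is_derive_glue {R : realType} (p : R) (f g df dg : R -> R) :
  (forall x : R, is_derive x 1 f (df x)) ->
  (forall x : R, is_derive x 1 g (dg x)) ->
  f p = g p -> df p = dg p ->
  forall x : R, is_derive x 1 (glue p f g) (glue p df dg x).
Proof.
move=> dfE dgE fgp dfgp x; have [->{x}|xp] := eqVneq x p; last first.
  exact: is_derive_glue_neq.
have cf : h^-1 *: ((f \o shift p) (h *: (1 : R)) - f p : R) @[h --> 0^'] --> df p.
  by have [/[swap] <-] := dfE p.
have cg : h^-1 *: ((g \o shift p) (h *: (1 : R)) - g p : R) @[h --> 0^'] --> dg p.
  by have [/[swap] <-] := dgE p.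
have c : h^-1 *: ((glue p f g \o shift p) (h *: (1 : R)) - glue p f g p : R) @[h --> 0^']
    --> glue p df dg p.
  apply/cvgrPdist_lt => e e0; near=> h.
  rewrite [glue p df dg p]/glue [glue p f g p]/glue lexx /= {1}/glue.
  case: ifP => _; last rewrite dfgp fgp.
    by near: h; apply: cvgr_dist_lt => //; exact: cf.
  by near: h; apply: cvgr_dist_lt => //; exact: cg.
apply: DeriveDef; first by apply/cvg_ex; exists (glue p df dg p).
by apply/cvg_lim.
Unshelve. all: by end_near. Qed.

(** * Local boundedness, measurability and local integrability *)

(** A bound at every point rather than almost everywhere: the pieces are continuous, and changing
    the value at one point does no harm. *)
Definition locally_bounded {R : realType} (f : R -> R) : Prop :=
  forall r : R, exists M : R, forall x, `|x| <= r -> `|f x| <= M.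

Lemma continuous_locally_bounded {R : realType} (f : R -> R) :
  continuous f -> locally_bounded f.
Proof.
move=> cf r; have cfr : {within `[- r, r], continuous f}.
  exact: continuous_subspaceT.
have /compact_bounded[M [_ Mf]] :=
  continuous_compact cfr (@segment_compact _ (- r) r).
exists (M + 1) => x; rewrite ler_norml => xr.
by apply: Mf; [rewrite ltrDl|exists x => //=; rewrite in_itv].
Qed.

Lemma locally_bounded_compact {R : realType} (f : R -> R) (K : set R) :
  locally_bounded f -> compact K -> exists M, forall x, K x -> `|f x| <= M.
Proof.
move=> bf /compact_bounded[N [_ NK]]; have [M Mf] := bf (N + 1).
by exists M => x Kx; apply/Mf/NK; rewrite ?ltrDl.
Qed.

Lemma locally_bounded_glue {R : realType} (p : R) (f g : R -> R) :
  locally_bounded f -> locally_bounded g -> locally_bounded (glue p f g).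
Proof.
move=> bf bg r; have [M Mf] := bf r; have [N Ng] := bg r.
exists (Num.max M N) => x xr; rewrite /glue le_max.
by case: ifP => _; rewrite (Mf, Ng) ?orbT.
Qed.

(** Meant for break points, where [derive1n 2] has an uncontrolled value: one exceptional point only
    brings [|f p|] into the maximum. *)
Lemma locally_bounded_modify {R : realType} (p : R) (f g : R -> R) :
  (forall x, x != p -> f x = g x) -> locally_bounded g -> locally_bounded f.
Proof.
move=> fg bg r; have [N Ng] := bg r.
exists (Num.max N `|f p|) => x xr; rewrite le_max.
by have [->|xp] := eqVneq x p; [rewrite lexx orbT|rewrite fg// Ng].
Qed.

Lemma measurable_glue {R : realType} (p : R) (f g : R -> R) :
  measurable_fun setT f -> measurable_fun setT g ->
  measurable_fun setT (glue p f g).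
Proof.
by move=> mf mg; apply: measurable_fun_ifT => //; exact: measurable_fun_ler.
Qed.

Lemma measurable_fun_modify {R : realType} (p : R) (f g : R -> R) :
  (forall x, x != p -> f x = g x) -> measurable_fun setT g ->
  measurable_fun setT f.
Proof.
move=> fg mg.
rewrite (_ : f = fun x => if x == p then cst (f p) x else g x); last first.
  by apply/funext => x; have [->|/fg] := eqVneq x p.
apply: measurable_fun_ifT => //; exact: measurable_fun_eqr.
Qed.

Lemma locally_bounded_integrable {R : realType} (f : R -> R) (K : set R) :
  measurable_fun setT f -> locally_bounded f -> compact K ->
  (@lebesgue_measure R).-integrable K (EFin \o f).
Proof.
move=> mf bf cK; apply: measurable_bounded_integrable.
- exact: compact_measurable.
- exact: compact_finite_measure.
- exact: measurable_funTS.
- have [M Mf] := locally_bounded_compact _ _ bf cK.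
  by exists M; split=> [|N MN x /Mf/le_trans]; [exact: num_real|apply; exact: ltW].
Qed.

Lemma locally_bounded_locally_integrable {R : realType} (f : R -> R) :
  measurable_fun setT f -> locally_bounded f ->
  locally_integrable [set: R] f.
Proof.
move=> mf bf; split=> [//||K _ cK]; first exact: openT.
by have /integrableP[] := locally_bounded_integrable _ _ mf bf cK.
Qed.

Lemma locally_bounded_Linfty_loc {R : realType} (f : R -> R) :
  measurable_fun setT f -> locally_bounded f -> Linfty_loc f.
Proof.
move=> mf bf; split=> [//|K cK].
have [M Mf] := locally_bounded_compact _ _ bf cK.
rewrite /finite_norm unlock /=; case: ifP => // _.
(* [|M|] replaces [M] because the patched function is 0 outside [K], while [M] may be negative when
   [K] is empty. *)
apply: (@le_lt_trans _ _ (`|M|)%:E); last exact: ltry.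
apply/ess_supP; apply: nearW => x /=; rewrite lee_fin /patch.
case: ifPn => [|_]; last by rewrite normr0.
by rewrite inE => /Mf /le_trans; apply; exact: ler_norm.
Qed.

Lemma locally_boundedM {R : realType} (f g : R -> R) :
  locally_bounded f -> locally_bounded g -> locally_bounded (f \* g).
Proof.
move=> bf bg r; have [M Mf] := bf r; have [N Ng] := bg r.
by exists (M * N) => x xr /=; rewrite normrM ler_pM// ?Mf ?Ng.
Qed.

Lemma is_derive_continuous {R : realType} (f df : R -> R) :
  (forall x : R, is_derive x 1 f (df x)) -> continuous f.
Proof.
move=> dfE x; apply: differentiable_continuous; apply/derivable1_diffP.
by have [] := dfE x.
Qed.

(** * Weak derivatives of piecewise smooth functions *)

Lemma Rintegral_itv_split {R : realType} (f : R -> R) (a b c : R) :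
  a <= b <= c -> (@lebesgue_measure R).-integrable `[a, c] (EFin \o f) ->
  \int[@lebesgue_measure R]_(x in `[a, c]) f x =
  \int[@lebesgue_measure R]_(x in `[a, b]) f x +
  \int[@lebesgue_measure R]_(x in `[b, c]) f x.
Proof.
move=> /andP[ab bc] intf.
have := @Rintegral_itvB R f (BLeft a) (BRight c) b intf.
rewrite !bnd_simp => /(_ ab bc) E; rewrite -(@Rintegral_itv_obnd_cbnd _ b).
  by rewrite -E addrC subrK.
by apply: integrableS intf => //; apply: subset_itvr; rewrite bnd_simp.
Qed.

(** The fundamental theorem of calculus for [h * phi] on one piece. Since [d] is uncontrolled at [a]
    and [b], the continuous [g] takes its place; the endpoints are negligible for the integral. *)
Lemma Rintegral_derive_parts {R : realType} (a b : R) (h d g phi : R -> R) :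
  a < b -> continuous h -> continuous g ->
  (forall x, x \in `]a, b[ -> is_derive x 1 h (d x)) ->
  (forall x, x \in `]a, b[ -> d x = g x) ->
  (forall x : R, derivable phi x 1) -> continuous (derive1 phi) ->
  (@lebesgue_measure R).-integrable `[a, b]
    (EFin \o (fun x => h x * derive1 phi x + d x * phi x)) ->
  \int[@lebesgue_measure R]_(x in `[a, b])
    (h x * derive1 phi x + d x * phi x) = h b * phi b - h a * phi a.
Proof.
move=> ab ch cg dh dg dphi cphi' intf.
pose k x := h x * derive1 phi x + g x * phi x.
have cphi : continuous phi.
  by move=> x; apply/differentiable_continuous/derivable1_diffP.
have ck : continuous k.
  move=> x; apply: cvgD; apply: cvgM;
    by [exact: ch|exact: cphi'|exact: cg|exact: cphi].
have intk : (@lebesgue_measure R).-integrable `[a, b] (EFin \o k).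
  by apply: continuous_compact_integrable;
    [exact: segment_compact|exact: continuous_subspaceT].
have soo_co : (`]a, b[%classic : set R) `<=` `[a, b[%classic.
  by apply: subset_itvr; rewrite bnd_simp.
have sco_cc : (`[a, b[%classic : set R) `<=` `[a, b]%classic.
  by apply: subset_itvl; rewrite bnd_simp.
have oo_cc (F : R -> R) : (@lebesgue_measure R).-integrable `[a, b] (EFin \o F) ->
    \int[@lebesgue_measure R]_(x in `[a, b]) F x =
    \int[@lebesgue_measure R]_(x in `]a, b[) F x.
  move=> iF; rewrite Rintegral_itv_obnd_cbnd; last first.
    by apply: integrableS iF => //; exact: subset_trans sco_cc.
  by rewrite Rintegral_itv_bndo_bndc//; exact: integrableS iF.
transitivity (\int[@lebesgue_measure R]_(x in `[a, b]) k x).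
  rewrite (oo_cc _ intf) (oo_cc _ intk).
  by apply: eq_Rintegral => x; rewrite inE/= => xab; rewrite dg.
rewrite /Rintegral.
rewrite (@continuous_FTC2 R k (h * phi) a b)//.
- exact: continuous_subspaceT.
- have chphi : continuous (h * phi) by move=> x; apply: cvgM; [exact: ch|exact: cphi].
  split => [x xab| |].
  + have [dhx _] := dh x xab; exact: derivableM dhx (dphi x).
  + by apply: cvg_at_right_filter; exact: chphi.
  + by apply: cvg_at_left_filter; exact: chphi.
- move=> x xab.
  have [_ DE] := is_deriveM (dh x xab) (derivableP (dphi x)).
  by rewrite derive1E DE /k dg// derive1E; congr (_ + _); rewrite mulrC.
Qed.

Lemma test_function_derivable {R : realType} (phi : R -> R) :
  test_function phi ->
  (forall x : R, derivable phi x 1) /\ continuous (derive1 phi).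
Proof.
move=> [dphi _]; split=> [|x]; first exact: (dphi 0).
by apply/differentiable_continuous/derivable1_diffP; exact: (dphi 1%N x).
Qed.

Lemma test_function_support {R : realType} (phi : R -> R) (r : R) :
  test_function phi ->
  exists2 b, r < b & forall x, b <= `|x| -> phi x = 0 /\ derive1 phi x = 0.
Proof.
move=> [_ /compact_bounded[N [_ NK]]].
(* [phi] vanishes where [|x|] exceeds [Num.max r N + 1]. The further unit leaves a neighbourhood of
   every [x] with [b <= |x|] on which [phi] is zero, so the derivative vanishes there too. *)
exists (Num.max r N + 2); first by rewrite ltr_pwDr// le_max lexx.
have phi0 x : Num.max r N + 1 < `|x| -> phi x = 0.
  move=> xb; apply/eqP; apply: contraTT xb => phix; rewrite -leNgt.
  by apply: NK; [rewrite ltr_pwDr// le_max lexx orbT|exact: subset_closure].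
move=> x xb; split.
  by apply: phi0; apply: lt_le_trans xb; rewrite ltrD2l; lra.
rewrite derive1E (@near_eq_derive _ _ _ _ (cst 0)); last first.
  near=> z; apply: phi0.
  have : `|x - z| < 1 by near: z; apply: cvgr_dist_lt => //; exact: cvg_id.
  by have := ler_distD z x 0; rewrite !subr0; lra.
exact: derive_cst.
Unshelve. all: by end_near. Qed.

(** Integration by parts on the three pieces: the boundary terms at [p] and [q] cancel because [h]
    is continuous, and those at the ends of the support of the test function are zero. The values of
    [d] at [p] and [q] do not matter. *)
Lemma glue_weak_derivative {R : realType} (p q : R) (h d g1 g2 g3 : R -> R) :
  p < q -> continuous h -> continuous g1 -> continuous g2 -> continuous g3 ->
  (forall x, x != p -> x != q -> d x = glue p g1 (glue q g2 g3) x) ->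
  (forall x : R, x != p -> x != q -> is_derive x 1 h (d x)) ->
  is_weak_derivative h d /\ Linfty_loc d.
Proof.
move=> pq ch cg1 cg2 cg3 dE dh.
(* [d'] differs from [d] only at [q] and from the glued function only at [p], so each modification
   lemma is applied to a single point. *)
pose d' x := if x == p then d p else glue p g1 (glue q g2 g3) x.
have dE1 x : x != q -> d x = d' x.
  by rewrite /d'; have [->//|xp xq] := eqVneq x p; exact: dE.
have dE2 x : x != p -> d' x = glue p g1 (glue q g2 g3) x.
  by rewrite /d' => /negbTE ->.
have bd : locally_bounded d.
  apply: locally_bounded_modify dE1 _; apply: locally_bounded_modify dE2 _.
  by do 2?apply: locally_bounded_glue; exact: continuous_locally_bounded.
have md : measurable_fun setT d.
  apply: measurable_fun_modify dE1 _; apply: measurable_fun_modify dE2 _.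
  by do 2?apply: measurable_glue; exact: continuous_measurable_fun.
have mh : measurable_fun setT h by exact: continuous_measurable_fun.
have bh := continuous_locally_bounded _ ch.
split; last exact: locally_bounded_Linfty_loc.
split; [exact: locally_bounded_locally_integrable..|move=> phi tphi].
have [dphi cphi'] := test_function_derivable _ tphi.
have cphi : continuous phi.
  by move=> x; apply/differentiable_continuous/derivable1_diffP.
(* The radius [|p| + |q|] puts both break points strictly inside []-b, b[]. *)
have [b rb phi0] := test_function_support _ (`|p| + `|q|) tphi.
have bp : - b < p < b by rewrite -ltr_norml; have := normr_ge0 q; lra.
have bq : - b < q < b by rewrite -ltr_norml; have := normr_ge0 p; lra.
have int1 : (@lebesgue_measure R).-integrable `[- b, b]
    (EFin \o (fun x => h x * derive1 phi x)).
  apply: locally_bounded_integrable; last exact: segment_compact.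
    by apply: measurable_funM => //; exact: continuous_measurable_fun.
  by apply: locally_boundedM => //; exact: continuous_locally_bounded.
have int2 : (@lebesgue_measure R).-integrable `[- b, b]
    (EFin \o (fun x => d x * phi x)).
  apply: locally_bounded_integrable; last exact: segment_compact.
    by apply: measurable_funM => //; exact: continuous_measurable_fun.
  by apply: locally_boundedM => //; exact: continuous_locally_bounded.
have supp (F : R -> R) : (forall x, b <= `|x| -> F x = 0) ->
    \int[@lebesgue_measure R]_x F x =
    \int[@lebesgue_measure R]_(x in `[- b, b]) F x.
  move=> F0; rewrite [RHS]Rintegral_mkcond; apply: eq_Rintegral => x _.
  rewrite /patch; case: ifPn => // /negP xb; apply: F0.
  by rewrite leNgt; apply/negP => /ltW; rewrite ler_norml => ?; apply: xb;
    rewrite inE /= in_itv.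
rewrite supp => [|x /phi0[_ ->]]; last by rewrite mulr0.
rewrite supp => [|x /phi0[-> _]]; last by rewrite mulr0.
apply/eqP; rewrite -addr_eq0 -RintegralD//.
pose F x := h x * derive1 phi x + d x * phi x.
have intF : (@lebesgue_measure R).-integrable `[- b, b] (EFin \o F).
  rewrite (_ : EFin \o F =
    (fun x => (h x * derive1 phi x)%:E + (d x * phi x)%:E)%E)//.
  exact: integrableD.
apply/eqP.
change (\int[@lebesgue_measure R]_(x in `[- b, b]) F x = 0).
have [[bp1 bp2] [bq1 bq2]] := (andP bp, andP bq).
have intFS u v : - b <= u -> v <= b ->
    (@lebesgue_measure R).-integrable `[u, v] (EFin \o F).
  by move=> ub vb; apply: integrableS intF => //; apply: subset_itv;
    rewrite bnd_simp.
rewrite (@Rintegral_itv_split _ _ _ p) ?(ltW bp1) ?ltW//.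
rewrite (@Rintegral_itv_split _ _ p q) ?(ltW pq) ?ltW//; last first.
  by apply: intFS => //; exact: ltW.
have E1 : \int[@lebesgue_measure R]_(x in `[- b, p]) F x =
    h p * phi p - h (- b) * phi (- b).
  apply: (@Rintegral_derive_parts _ _ _ h d g1) => // [x|x|].
  - rewrite in_itv/= => /andP[_ xp].
    by apply: dh; rewrite lt_eqF// (lt_trans xp).
  - rewrite in_itv/= => /andP[_ xp].
    have xq := lt_trans xp pq.
    by rewrite dE ?(lt_eqF xp) ?(lt_eqF xq)// /glue (ltW xp).
  - by apply: intFS => //; exact: ltW.
have E2 : \int[@lebesgue_measure R]_(x in `[p, q]) F x =
    h q * phi q - h p * phi p.
  apply: (@Rintegral_derive_parts _ _ _ h d g2) => // [x|x|].
  - rewrite in_itv/= => /andP[px xq].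
    by apply: dh; [rewrite gt_eqF|rewrite lt_eqF].
  - rewrite in_itv/= => /andP[px xq].
    by rewrite dE ?(gt_eqF px) ?(lt_eqF xq)// /glue leNgt px (ltW xq).
  - by apply: intFS; exact: ltW.
have E3 : \int[@lebesgue_measure R]_(x in `[q, b]) F x =
    h b * phi b - h q * phi q.
  apply: (@Rintegral_derive_parts _ _ _ h d g3) => // [x|x|].
  - rewrite in_itv/= => /andP[qx _].
    by apply: dh; rewrite gt_eqF// (lt_trans pq).
  - rewrite in_itv/= => /andP[qx _]; have px := lt_trans pq qx.
    by rewrite dE ?(gt_eqF px) ?(gt_eqF qx)// /glue !leNgt px qx.
  - by apply: intFS => //; exact: ltW.
rewrite E1 E2 E3.
have [-> _] : phi b = 0 /\ derive1 phi b = 0 by apply: phi0; exact: ler_norm.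
have [-> _] : phi (- b) = 0 /\ derive1 phi (- b) = 0.
  by apply: phi0; rewrite normrN ler_norm.
by ring.
Qed.

(** * Regularity and growth of functions with two break points *)

Lemma is_derive_glue2 {R : realType} (p q : R)
    (f1 f2 f3 df1 df2 df3 : R -> R) :
  p < q ->
  (forall x : R, is_derive x 1 f1 (df1 x)) ->
  (forall x : R, is_derive x 1 f2 (df2 x)) ->
  (forall x : R, is_derive x 1 f3 (df3 x)) ->
  f1 p = f2 p -> f2 q = f3 q -> df1 p = df2 p -> df2 q = df3 q ->
  forall x : R, is_derive x 1 (glue p f1 (glue q f2 f3))
    (glue p df1 (glue q df2 df3) x).
Proof.
move=> pq d1 d2 d3 f12 f23 df12 df23; apply: is_derive_glue => //.
- exact: is_derive_glue.
- by rewrite /glue ltW.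
- by rewrite /glue ltW.
Qed.

(** First-order fit at [p] and [q] makes the glued function C1. The second derivatives of the pieces
    may disagree there, which costs continuity but not local boundedness. *)
Lemma glue2_C2_off {R : realType} (p q : R)
    (f1 f2 f3 df1 df2 df3 ddf1 ddf2 ddf3 : R -> R) :
  p < q ->
  (forall x : R, is_derive x 1 f1 (df1 x)) ->
  (forall x : R, is_derive x 1 f2 (df2 x)) ->
  (forall x : R, is_derive x 1 f3 (df3 x)) ->
  (forall x : R, is_derive x 1 df1 (ddf1 x)) ->
  (forall x : R, is_derive x 1 df2 (ddf2 x)) ->
  (forall x : R, is_derive x 1 df3 (ddf3 x)) ->
  f1 p = f2 p -> f2 q = f3 q -> df1 p = df2 p -> df2 q = df3 q ->
  continuous ddf1 -> continuous ddf2 -> continuous ddf3 ->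
  let w := glue p f1 (glue q f2 f3) in
  [/\ C1 w, second_derivative_Linfty_loc w &
    forall x, x != p -> x != q -> twice_derivable_at w x /\
      derive1n 2 w x = glue p ddf1 (glue q ddf2 ddf3) x].
Proof.
move=> pq d1 d2 d3 dd1 dd2 dd3 f12 f23 df12 df23 c1 c2 c3 w.
have dw := is_derive_glue2 _ _ _ _ _ _ _ _ pq d1 d2 d3 f12 f23 df12 df23.
have w'E : derive1 w = glue p df1 (glue q df2 df3).
  by apply/funext => x; rewrite derive1E; have [_ ->] := dw x.
have w'C : continuous (derive1 w).
  rewrite w'E; apply: continuous_glue; last by rewrite /glue ltW.
    exact: is_derive_continuous dd1.
  by apply: continuous_glue => //;
    [exact: is_derive_continuous dd2|exact: is_derive_continuous dd3].
have ddw x : x != p -> x != q ->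
    is_derive x 1 (derive1 w) (glue p ddf1 (glue q ddf2 ddf3) x).
  move=> xp xq; rewrite w'E; apply: is_derive_glue_neq => //.
  exact: is_derive_glue_neq.
have ddwE x : x != p -> x != q ->
    derive1n 2 w x = glue p ddf1 (glue q ddf2 ddf3) x.
  by move=> xp xq; rewrite /derive1n/= derive1E; have [_ ->] := ddw x xp xq.
have derw x : derivable w x 1 by have [] := dw x.
split; first by split.
  have ddw' x : x != p -> x != q ->
      is_derive x 1 (derive1 w) (derive1n 2 w x).
    by move=> xp xq; rewrite ddwE//; exact: ddw.
  exact (glue_weak_derivative p q (derive1 w) (derive1n 2 w) ddf1 ddf2 ddf3
    pq w'C c1 c2 c3 ddwE ddw').
move=> x xp xq; split; last exact: ddwE.
by split; [exact: filterE|have [] := ddw x xp xq].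
Qed.

Lemma pde_ineq_ae_off {R : realType} (r l s p q : R) (u v : R -> R) :
  (forall x, x != p -> x != q ->
    twice_derivable_at u x /\ generator r l s u v x <= 0) ->
  pde_ineq_ae r l s u v.
Proof.
move=> H; exists [set p; q]; split.
- by apply: measurableU; exact: measurable_set1.
- exact/countable_lebesgue_measure0/finite_set_countable/finite_set2.
- move=> x /= nP; apply: contrapT => /not_orP[/eqP xp /eqP xq].
  by apply: nP; exact: H.
Qed.

(** Three regions: bounded on the left half-line, continuous on a compact set in the middle, affine
    on the right. The summand 1 in [kappa] keeps it positive. *)
Lemma linear_growth_off {R : realType} (w : R -> R) (p q M th : R) :
  continuous w -> (forall x, x <= p -> `|w x| <= M) ->
  (forall x, q < x -> w x = x - th) -> linear_growth w.
Proof.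
move=> cw wM wth.
have [N wN] := continuous_locally_bounded _ cw (`|p| + `|q|).
have M0 : 0 <= M by apply: le_trans (wM p (lexx _)).
have N0 : 0 <= N by apply: le_trans (wN 0 _); rewrite ?normr0 ?addr_ge0.
exists (M + N + `|th| + 1) => [|x]; first by rewrite ltr_wpDl// !addr_ge0.
have x0 := normr_ge0 x; have th0 := normr_ge0 th.
have [xp|px] := leP x p.
  by apply: le_trans (wM x xp) _; nra.
have [xq|qx] := leP x q.
  apply: (@le_trans _ _ N); last by nra.
  apply: wN; rewrite ler_norml.
  have := ler_norm q; have := ler_norm (- p); rewrite normrN => *.
  by apply/andP; split; have := normr_ge0 p; have := normr_ge0 q; lra.
by rewrite wth//; have := ler_normB x th; nra.
Qed.

(** * Exponential sums *)

(** The class is stable under differentiation with [k] and [l] fixed, so one derivative rule serves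
    for every branch and for all its derivatives. *)
Definition expsum {R : realType} (a k b l m n x : R) : R :=
  a * expR (k * x) + b * expR (l * x) + (m * x + n).

Lemma is_derive_expsum {R : realType} (a k b l m n x : R) :
  is_derive x 1 (expsum a k b l m n) (expsum (a * k) k (b * l) l 0 m x).
Proof.
have dl (c : R) : is_derive x 1 (fun x => c * x) c.
  have := is_deriveZ c (is_derive_id x (1 : R)).
  by rewrite /GRing.scale/= mulr1.
have de (c e : R) : is_derive x 1 (fun x => c * expR (e * x)) (c * e * expR (e * x)).
  have := is_deriveZ c (is_derive1_comp (is_derive_expR (e * x)) (dl e)).
  by move=> H; apply: (is_derive_eq H); rewrite /GRing.scale/= mulrCA mulrC.
have dm : is_derive x 1 (fun x => m * x + n) m.
  by have := is_deriveD (dl m) (is_derive_cst n x 1); rewrite addr0.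
have := is_deriveD (is_deriveD (de a k) (de b l)) dm.
by move=> H; apply: (is_derive_eq H); rewrite /expsum mul0r add0r.
Qed.

Lemma continuous_expsum {R : realType} (a k b l m n : R) :
  continuous (expsum a k b l m n).
Proof. exact: is_derive_continuous (is_derive_expsum a k b l m n). Qed.

Lemma expsum_bounded_left {R : realType} (a k b l n p x : R) :
  0 <= k -> 0 <= l -> x <= p ->
  `|expsum a k b l 0 n x| <= `|a| * expR (k * p) + `|b| * expR (l * p) + `|n|.
Proof.
move=> k0 l0 xp; rewrite /expsum mul0r add0r.
apply: le_trans (ler_normD _ _) _; rewrite lerD2r.
apply: le_trans (ler_normD _ _) _.
rewrite !normrM !(@ger0_norm _ (expR _)) ?expR_ge0//.
by apply: lerD; rewrite ler_wpM2l// ler_expR ler_wpM2l.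
Qed.

(** * Monotonicity arguments, exponential inequalities, signs at the characteristic roots *)

Lemma ler_is_derive {R : realType} (f df : R -> R) (a b : R) :
  (forall x : R, is_derive x 1 f (df x)) -> a <= b ->
  (forall x, a <= x <= b -> 0 <= df x) -> f a <= f b.
Proof.
move=> dfE ab df0; apply: (@ger0_derive1_ndecr _ f a b) => //.
- move=> x; rewrite in_itv/= derive1E => /andP[ax xb].
  by have [_ ->] := dfE x; rewrite df0// !ltW.
- by apply: continuous_subspaceT; exact: is_derive_continuous dfE.
Qed.

Lemma convex_ge0 {R : realType} (f df ddf : R -> R) :
  (forall x : R, is_derive x 1 f (df x)) ->
  (forall x : R, is_derive x 1 df (ddf x)) ->
  (forall x, 0 <= x -> 0 <= ddf x) -> 0 <= df 0 -> 0 <= f 0 ->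
  forall x, 0 <= x -> 0 <= f x.
Proof.
move=> dfE ddfE ddf0 df0 f0 x x0; apply: le_trans f0 _.
apply: ler_is_derive dfE x0 _ => y /andP[y0 _]; apply: le_trans df0 _.
by apply: ler_is_derive ddfE y0 _ => z /andP[z0 _]; exact: ddf0.
Qed.

Lemma ler_expsum {R : realType} (a k b l m n s t : R) :
  s <= t ->
  (forall x, s <= x <= t -> 0 <= expsum (a * k) k (b * l) l 0 m x) ->
  expsum a k b l m n s <= expsum a k b l m n t.
Proof. exact: ler_is_derive (is_derive_expsum a k b l m n). Qed.

(* The two sides are affine in V; at V = s this is [sinh s <= s cosh s]. *)
Lemma expR_middle_ge {R : realType} (s V : R) : 0 <= s <= V ->
  2 * (V - s) <= (V + 1) * expR (- s) + (V - 1) * expR s.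
Proof.
move=> /andP[s0 sV].
have dN (x : R) : is_derive x 1 (fun x => expR (- x)) (- expR (- x)).
  by apply: is_derive_eq (is_derive1_comp (is_derive_expR (- x))
    (is_deriveN (is_derive_id x (1 : R)))) _; rewrite mulrN1.
(* [j s] is the right side at [V = s] and equals [2 (s cosh s - sinh s)]; its derivative is
   [2 s sinh s]. *)
pose j (x : R) := (x + 1) * expR (- x) + (x - 1) * expR x.
have dj (x : R) : is_derive x 1 j (x * (expR x - expR (- x))).
  have dD (c : R) : is_derive x 1 (fun x => x + c) 1.
    by have := is_deriveD (is_derive_id x (1 : R)) (is_derive_cst c x 1);
      rewrite addr0.
  have := is_deriveD (is_deriveM (dD 1) (dN x))
    (is_deriveM (dD (-1)) (is_derive_expR x)).
  by move=> H; apply: (is_derive_eq H); rewrite /GRing.scale/=; ring.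
have j0 : 0 <= j s.
  have -> : 0 = j 0 by rewrite /j oppr0 expR0; ring.
  apply: ler_is_derive dj s0 _ => x /andP[x0 _].
  by rewrite mulr_ge0// subr_ge0 ler_expR; lra.
have E : expR (- s) * expR s = 1 by rewrite -expRD addNr expR0.
have := expR_gt0 s; have := expR_gt0 (- s); move: j0 E; rewrite /j.
set e := expR (- s); set f := expR s => j0 E e0 f0.
have ef2 : 2 <= e + f by have := sqr_ge0 (e - f); nra.
(* Passing from [V = s] to a larger [V] adds exactly this product to the right side minus the left
   side. *)
have := mulr_ge0 (_ : 0 <= V - s) (_ : 0 <= e + f - 2).
by rewrite !subr_ge0 => /(_ sV ef2); lra.
Qed.

(** Equality holds at [s = 0], and [expR_middle_ge] makes the left side nonincreasing in [s] on
    [[0, V]]. *)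
Lemma expR_middle_le {R : realType} (s V : R) : 0 <= s <= V ->
  (V + 1) * expR (- s) - (V - 1) * expR s <= 2.
Proof.
move=> /andP[s0 sV].
pose g := expsum (- (V + 1)) (-1) (V - 1) 1 0 (2 : R).
suff : g 0 <= g s.
  by rewrite /g /expsum !mulr0 !mul0r !expR0 mulN1r mul1r; lra.
apply: ler_expsum s0 _ => x /andP[x0 xs].
have := @expR_middle_ge R x V; rewrite x0 (le_trans xs sV) => /(_ isT).
by rewrite /expsum mulN1r mul1r; lra.
Qed.

(** The right side minus the left side is affine in [u] with slope [X t <= 0], so the worst case is
    the largest admissible [u], where [al * be * u = al + be]. It is used with [u = x1 - th] and
    [t = x1 - x]. *)
Lemma expsum_ge_tangent {R : realType} (al be u t : R) : 0 < al < be ->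
  al * be * u <= al + be -> 0 <= t ->
  (be - al) * (u - t) <=
    (be * u - 1) * expR (- (al * t)) + (1 - al * u) * expR (- (be * t)).
Proof.
move=> /andP[al0 albe] key t0; have be0 : 0 < be by lra.
pose X := expsum be (- al) (- al) (- be) 0 (- (be - al)).
have X0 s : 0 <= s -> X s <= 0.
  move=> s0; rewrite -oppr_ge0.
  have -> : - X s = expsum (- be) (- al) al (- be) 0 (be - al) s.
    by rewrite /X /expsum; ring.
  rewrite [leLHS](_ : 0 = expsum (- be) (- al) al (- be) 0 (be - al) 0);
    last by rewrite /expsum !mulr0 !expR0; ring.
  apply: ler_expsum s0 _ => x /andP[x0 _].
  rewrite /expsum.
  have : expR (- be * x) <= expR (- al * x) by rewrite ler_expR; nra.
  have : 0 < al * be by rewrite mulr_gt0.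
  by nra.
(* [Z] is [al * be] times the difference of the two sides in the extreme case
   [al * be * u = al + be]; its derivative is [- (al * be * X)]. *)
pose Z := expsum (be ^+ 2) (- al) (- al ^+ 2) (- be) (al * be * (be - al))
  (- (be ^+ 2 - al ^+ 2)).
have Z0 : 0 <= Z t.
  have -> : 0 = Z 0 by rewrite /Z /expsum !mulr0 !expR0; ring.
  apply: ler_expsum t0 _ => x /andP[x0 _].
  have := X0 x x0; have : 0 < al * be by rewrite mulr_gt0.
  rewrite (_ : expsum _ _ _ _ _ _ _ = - (al * be * X x)); first by nra.
  by rewrite /X /expsum; ring.
have := X0 t t0; move: Z0; rewrite /Z /X /expsum !mulNr.
set a := expR _; set b := expR _ => Z0 Xt.
have ab0 : 0 < al * be by rewrite mulr_gt0.
rewrite -subr_ge0 -(pmulr_rge0 _ ab0).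
have := mulr_ge0 (_ : 0 <= al + be - al * be * u)
  (_ : 0 <= - (be * a + - (al * b) + (0 * t - (be - al)))).
rewrite subr_ge0 oppr_ge0 => /(_ key Xt); nra.
Qed.

(** Both factors decrease in [z], and at a root they share a sign since [0 < L]. If both were
    negative at [z3], or both positive at [z4], the products at the two roots would differ. Here [z]
    stands for the square of a characteristic root. *)
Lemma char_root_signs {R : realType} (A B s1 s2 L z3 z4 : R) :
  0 < s1 -> 0 < s2 -> 0 < L -> z3 < z4 ->
  (A - s1 * z3) * (B - s2 * z3) = L -> (A - s1 * z4) * (B - s2 * z4) = L ->
  0 < A - s1 * z3 /\ A - s1 * z4 < 0.
Proof.
move=> s10 s20 L0 z34 E3 E4.
have d1 : A - s1 * z4 < A - s1 * z3 by rewrite ltrD2l ltrN2 ltr_pM2l.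
have d2 : B - s2 * z4 < B - s2 * z3 by rewrite ltrD2l ltrN2 ltr_pM2l.
move: E3 E4 d1 d2; set a := A - _; set b := B - _.
set a' := A - _; set b' := B - _ => E3 E4 d1 d2.
split; rewrite ltNge; apply/negP => sg.
- have b0 : b < 0 by nra.
  have : L < L by rewrite -{1}E3 -E4; nra.
  by rewrite ltxx.
- have b0 : 0 < b' by nra.
  have : L < L by rewrite -{1}E4 -E3; nra.
  by rewrite ltxx.
Qed.

(** As [0 <= C] multiplies the slower exponential, nonnegativity of the second derivative at [t = 0]
    propagates to all [t >= 0]. A convex function that starts above a line, with at least its slope,
    stays above it. *)
Lemma decaying_expsum_ge_tangent {R : realType} (al be C D c u t : R) :
  0 < al < be -> 0 <= C -> 0 <= al ^+ 2 * C + be ^+ 2 * D ->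
  0 <= c -> c * u <= C + D -> al * C + be * D <= c -> 0 <= t ->
  c * (u - t) <= C * expR (- (al * t)) + D * expR (- (be * t)).
Proof.
move=> /andP[al0 albe] C0 CD2 c0 CD0 CD1 t0.
pose N := expsum C (- al) D (- be) c (- (c * u)).
suff : 0 <= N t by rewrite /N /expsum !mulNr; lra.
apply: (convex_ge0 _ _ _ (is_derive_expsum _ _ _ _ _ _)
  (is_derive_expsum _ _ _ _ _ _) _ _ _ t t0).
- move=> x x0; rewrite /expsum.
  have : expR (- be * x) <= expR (- al * x) by rewrite ler_expR; nra.
  have := expR_ge0 (- be * x); set e := expR _; set f := expR _ => e0 ef.
  have aC : 0 <= al ^+ 2 * C by rewrite mulr_ge0 ?sqr_ge0.
  have fe : 0 <= f - e by rewrite subr_ge0.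
  have := mulr_ge0 aC fe.
  have := mulr_ge0 CD2 e0; lra.
- by rewrite /expsum !mulr0 !expR0; lra.
- by rewrite /expsum !mulr0 !expR0; lra.
Qed.

(** * The middle branch of [w2]: bounds, and fit at [x1] *)

Lemma alpha5_gt0 {R : realType} (M : model R) :
  0 < rho M -> 0 < lambda2 M -> 0 < sigma2 M -> 0 < alpha5 M.
Proof.
by move=> r0 l0 s0; rewrite sqrtr_gt0 divr_gt0 ?exprn_gt0// mulr_gt0 ?addr_gt0.
Qed.

Lemma alpha5_sqr {R : realType} (M : model R) :
  0 < rho M -> 0 < lambda2 M -> 0 < sigma2 M ->
  2^-1 * sigma2 M ^+ 2 * alpha5 M ^+ 2 = rho M + lambda2 M.
Proof.
move=> r0 l0 s0; rewrite sqr_sqrtr; first by field; rewrite gt_eqF.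
by rewrite divr_ge0 ?exprn_ge0 ?mulr_ge0 ?addr_ge0 ?ltW.
Qed.

Definition middle_branch {R : realType} (M : model R) (th x2 : R) : R -> R :=
  expsum (B5 M th x2) (alpha5 M) (B6 M th x2) (- alpha5 M)
    (lambda2 M / (rho M + lambda2 M)) (- (lambda2 M / (rho M + lambda2 M) * th)).

(** Recentring at [x2] leaves only [alpha5 M * (x2 - x)] in the exponent, the form in which the
    hyperbolic terms of [F1] and [F2] appear. *)
Lemma B5_expR {R : realType} (M : model R) (th x2 x : R) :
  alpha5 M != 0 ->
  B5 M th x2 * expR (alpha5 M * x) =
  rho M / (rho M + lambda2 M) / (2 * alpha5 M) *
    ((alpha5 M * (x2 - th) + 1) * expR (- (alpha5 M * (x2 - x)))).
Proof.
move=> g0; rewrite /B5 (_ : - (alpha5 M * (x2 - x)) =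
  - (alpha5 M * x2) + alpha5 M * x); last by ring.
rewrite expRD; set k := rho M / _; set e := expR _; set f := expR _.
by field.
Qed.

Lemma B6_expR {R : realType} (M : model R) (th x2 x : R) :
  alpha5 M != 0 ->
  B6 M th x2 * expR (- alpha5 M * x) =
  rho M / (rho M + lambda2 M) / (2 * alpha5 M) *
    ((alpha5 M * (x2 - th) - 1) * expR (alpha5 M * (x2 - x))).
Proof.
move=> g0; rewrite /B6 (_ : alpha5 M * (x2 - x) =
  alpha5 M * x2 + - alpha5 M * x); last by ring.
rewrite expRD; set k := rho M / _; set e := expR _; set f := expR _.
by field.
Qed.

(** The two [expR_middle] inequalities with [s = alpha5 M * (x2 - x)] and
    [V = alpha5 M * (x2 - th)]. After adding the affine part of the branch, the conclusions read:
    value at least [x - th], slope at most 1, convexity. *)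
Lemma middle_branch_bounds {R : realType} (M : model R) (th x2 x : R) :
  0 < rho M -> 0 < lambda2 M -> 0 < sigma2 M -> th <= x <= x2 ->
  let P := B5 M th x2 * expR (alpha5 M * x) in
  let Q := B6 M th x2 * expR (- alpha5 M * x) in
  let k := rho M / (rho M + lambda2 M) in
  [/\ k * (x - th) <= P + Q, alpha5 M * (P - Q) <= k & 0 <= P + Q].
Proof.
move=> r0 l0 s0 /andP[thx xx2]; have g0 := alpha5_gt0 M r0 l0 s0.
move=> P Q k; rewrite /P /Q B5_expR ?gt_eqF// B6_expR ?gt_eqF// -/k.
move: g0; set g := alpha5 M => g0.
have k0 : 0 < k by rewrite divr_gt0// addr_gt0.
have sV : 0 <= g * (x2 - x) <= g * (x2 - th).
  by rewrite mulr_ge0 ?subr_ge0 ?(ltW g0)// ler_pM2l// lerD2l lerN2.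
have := expR_middle_ge _ _ sV; have := expR_middle_le _ _ sV.
set e := expR (- _); set f := expR _ => le2 ge2.
have lo : k * (x - th) <=
    k / (2 * g) * ((g * (x2 - th) + 1) * e) + k / (2 * g) * ((g * (x2 - th) - 1) * f).
  rewrite -mulrDr -mulrA ler_pM2l// mulrC ler_pdivlMr ?mulr_gt0//.
  by apply: le_trans ge2; lra.
split => //.
- rewrite -mulrBr (_ : g * _ = k / 2 *
    ((g * (x2 - th) + 1) * e - (g * (x2 - th) - 1) * f)).
    have k2 : 0 <= k / 2 by rewrite divr_ge0// ltW.
    by have := ler_wpM2l k2 le2; lra.
  by field; rewrite gt_eqF.
- by apply: le_trans lo; rewrite mulr_ge0 ?subr_ge0// ltW.
Qed.

(** The right side is the left branch of [w2] at [x1], so [F1 = 0] is continuity there. *)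
Lemma middle_branch_fit_value {R : realType} (M : model R)
    (al3 al4 th x1 x2 : R) :
  0 < rho M -> 0 < lambda1 M -> 0 < lambda2 M -> 0 < sigma2 M -> al3 < al4 ->
  F1 M al3 al4 th x1 x2 = 0 ->
  middle_branch M th x2 x1 =
  (Phi1 M al3 * (al4 * (x1 - th) - 1) + Phi1 M al4 * (1 - al3 * (x1 - th))) /
    (lambda1 M * (al4 - al3)).
Proof.
move=> r0 l10 l20 s0 al34; have g0 := alpha5_gt0 M r0 l20 s0.
rewrite /F1 /cosh /sinh /middle_branch /expsum B5_expR ?gt_eqF//.
rewrite B6_expR ?gt_eqF// /a1 /a2.
set e := expR (- _); set f := expR _.
move: (Phi1 M al3) (Phi1 M al4) => P1 P2.
move: (rho M) (lambda1 M) (lambda2 M) (alpha5 M) r0 l10 l20 g0 @e @f.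
move=> r l1 l2 g r0 l10 l20 g0 e f; move=> F0.
(* Subtracting the vanishing [F1] leaves a rational identity in which the exponentials [e] and [f]
   are independent indeterminates. *)
rewrite -[LHS]subr0 -{1}F0; field.
by rewrite !gt_eqF ?subr_gt0 ?addr_gt0.
Qed.

(** The two sides are the right and left derivatives of [w2] at [x1], so [F2 = 0] is the fit of
    slopes. *)
Lemma middle_branch_fit_slope {R : realType} (M : model R)
    (al3 al4 th x1 x2 : R) :
  0 < rho M -> 0 < lambda1 M -> 0 < lambda2 M -> 0 < sigma2 M -> al3 < al4 ->
  F2 M al3 al4 th x1 x2 = 0 ->
  alpha5 M * (B5 M th x2 * expR (alpha5 M * x1)
    - B6 M th x2 * expR (- alpha5 M * x1)) + lambda2 M / (rho M + lambda2 M) =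
  (al3 * Phi1 M al3 * (al4 * (x1 - th) - 1) +
    al4 * Phi1 M al4 * (1 - al3 * (x1 - th))) / (lambda1 M * (al4 - al3)).
Proof.
move=> r0 l10 l20 s0 al34; have g0 := alpha5_gt0 M r0 l20 s0.
rewrite /F2 /cosh /sinh B5_expR ?gt_eqF//.
rewrite B6_expR ?gt_eqF// /a3 /a4.
set e := expR (- _); set f := expR _.
move: (Phi1 M al3) (Phi1 M al4) => P1 P2.
move: (rho M) (lambda1 M) (lambda2 M) (alpha5 M) r0 l10 l20 g0 @e @f.
move=> r l1 l2 g r0 l10 l20 g0 e f; move=> F0.
rewrite -[LHS]subr0 -{1}F0; field.
by rewrite !gt_eqF ?subr_gt0 ?addr_gt0.
Qed.

(** * The left branches and the position of the free boundary *)

Lemma A3_expR {R : realType} (al3 al4 th x1 x : R) :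
  A3 al3 al4 th x1 * expR (al3 * x) =
  (al4 * (x1 - th) - 1) / (al4 - al3) * expR (- (al3 * (x1 - x))).
Proof. by rewrite /A3 -[LHS]mulrA -expRD; congr (_ * expR _); ring. Qed.

Lemma A4_expR {R : realType} (al3 al4 th x1 x : R) :
  A4 al3 al4 th x1 * expR (al4 * x) =
  (1 - al3 * (x1 - th)) / (al4 - al3) * expR (- (al4 * (x1 - x))).
Proof. by rewrite /A4 -[LHS]mulrA -expRD; congr (_ * expR _); ring. Qed.

(* If the left branch of w(.,1) were concave at the free boundary, its third
   derivative there would force w_x(x1,2) > 1. *)
Lemma free_boundary_le {R : realType} (A s l al be u : R) :
  0 < s -> 0 < l -> l <= A -> 0 < al < be ->
  (al * (- (s * al ^+ 2) + A) * (be * u - 1) +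
    be * (- (s * be ^+ 2) + A) * (1 - al * u)) / (l * (be - al)) <= 1 ->
  al * be * u <= al + be.
Proof.
move=> s0 l0 lA /andP[al0 albe].
have be0 : 0 < be by lra.
rewrite ler_pdivrMr ?mulr_gt0 ?subr_gt0// mul1r.
rewrite (_ : _ + _ = (A - s * (al ^+ 2 + al * be + be ^+ 2) +
  s * (al + be) * (al * be * u)) * (be - al)); last by ring.
rewrite ler_pM2r ?subr_gt0// => H; rewrite leNgt; apply/negP => key.
have sab : 0 < s * (al + be) by rewrite mulr_gt0// addr_gt0.
(* Since [(al + be)^2] exceeds [al^2 + al be + be^2] by [al be], [H] would give [A + s al be < l],
   against [l <= A]. *)
have : s * (al + be) * (al + be) < s * (al + be) * (al * be * u).
  by rewrite ltr_pM2l.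
have : 0 < s * al * be by rewrite !mulr_gt0.
lra.
Qed.

Lemma left_branch1_ge {R : realType} (al3 al4 th x1 x : R) :
  0 < al3 < al4 -> al3 * al4 * (x1 - th) <= al3 + al4 -> x <= x1 ->
  x - th <= A3 al3 al4 th x1 * expR (al3 * x) + A4 al3 al4 th x1 * expR (al4 * x).
Proof.
move=> hal key xx1; have t0 : 0 <= x1 - x by rewrite subr_ge0.
have := expsum_ge_tangent _ _ _ _ hal key t0.
move: hal => /andP[_ al34].
rewrite A3_expR A4_expR ![_ / _ * expR _]mulrAC -mulrDl.
by rewrite ler_pdivlMr ?subr_gt0//; lra.
Qed.

Lemma B3_B4_expR {R : realType} (M : model R) (al3 al4 th x1 x : R) :
  lambda1 M != 0 -> al4 - al3 != 0 ->
  B3 M al3 al4 th x1 * expR (al3 * x) + B4 M al3 al4 th x1 * expR (al4 * x) =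
  (Phi1 M al3 * (al4 * (x1 - th) - 1) * expR (- (al3 * (x1 - x))) +
   Phi1 M al4 * (1 - al3 * (x1 - th)) * expR (- (al4 * (x1 - x)))) /
    (lambda1 M * (al4 - al3)).
Proof.
move=> l0 d0; rewrite /B3 /B4 -[_ * A3 _ _ _ _ * _]mulrA.
rewrite -[_ * A4 _ _ _ _ * _]mulrA A3_expR A4_expR.
set e := expR _; set f := expR _; move: (Phi1 _ _) (Phi1 _ _) => P1 P2.
by field; rewrite l0 d0.
Qed.

(** An instance of [decaying_expsum_ge_tangent] in [t = x1 - x], with [c = lambda1 M * (al4 - al3)]
    and [u = x1 - th]. The data at [t = 0] come from the middle branch through the fit of value and
    slope. *)
Lemma left_branch2_ge {R : realType} (M : model R) (al3 al4 th x1 x2 x : R) :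
  0 < rho M -> 0 < lambda1 M -> 0 < lambda2 M -> 0 < sigma2 M ->
  0 < al3 < al4 -> 0 < Phi1 M al3 -> Phi1 M al4 < 0 ->
  is_char_root M al3 -> is_char_root M al4 -> th < x1 < x2 ->
  F1 M al3 al4 th x1 x2 = 0 -> F2 M al3 al4 th x1 x2 = 0 -> x <= x1 ->
  x - th <= B3 M al3 al4 th x1 * expR (al3 * x) +
            B4 M al3 al4 th x1 * expR (al4 * x).
Proof.
move=> r0 l10 l20 s20 hal P10 P20 hal3 hal4 /andP[thx1 x12] hF1 hF2 xx1.
have /andP[al0 al34] := hal; have be0 : 0 < al4 by lra.
have c0 : 0 < lambda1 M * (al4 - al3) by rewrite mulr_gt0 ?subr_gt0.
rewrite B3_B4_expR ?gt_eqF ?subr_gt0// ler_pdivlMr// mulrC.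
have -> : x - th = (x1 - th) - (x1 - x) by ring.
have x1in : th <= x1 <= x2 by rewrite !ltW.
have [lo hi pos] := middle_branch_bounds M th x2 x1 r0 l20 s20 x1in.
have fit := middle_branch_fit_value _ _ _ _ _ _ r0 l10 l20 s20 al34 hF1.
have fit' := middle_branch_fit_slope _ _ _ _ _ _ r0 l10 l20 s20 al34 hF2.
move: lo hi pos fit fit'; rewrite /middle_branch /expsum.
set P := B5 M th x2 * _; set Q := B6 M th x2 * _ => lo hi pos fit fit'.
have rl0 : 0 < rho M + lambda2 M by rewrite addr_gt0.
have kE : lambda2 M / (rho M + lambda2 M) = 1 - rho M / (rho M + lambda2 M).
  by field; rewrite gt_eqF.
have val : lambda1 M * (al4 - al3) *
    (P + Q + lambda2 M / (rho M + lambda2 M) * (x1 - th)) =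
    Phi1 M al3 * (al4 * (x1 - th) - 1) + Phi1 M al4 * (1 - al3 * (x1 - th)).
  by rewrite [_ * (x1 - th)]mulrBr fit mulrC divfK// gt_eqF.
have val_ge : lambda1 M * (al4 - al3) * (x1 - th) <=
    Phi1 M al3 * (al4 * (x1 - th) - 1) + Phi1 M al4 * (1 - al3 * (x1 - th)).
  by rewrite -val ler_pM2l// kE; lra.
(* Otherwise [al4 * (x1 - th) < 1], hence also [al3 * (x1 - th) < 1], and both coefficients are
   negative. The value at [x1] would then be negative, although it is at least [x1 - th > 0]. *)
have C0 : 0 <= Phi1 M al3 * (al4 * (x1 - th) - 1).
  rewrite leNgt; apply/negP => C0.
  have : al4 * (x1 - th) - 1 < 0 by rewrite -(pmulr_rlt0 _ P10).
  move=> bu; have au : 0 < 1 - al3 * (x1 - th).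
    by have : al3 * (x1 - th) < al4 * (x1 - th); [rewrite ltr_pM2r ?subr_gt0|lra].
  have : Phi1 M al4 * (1 - al3 * (x1 - th)) < 0 by rewrite nmulr_rlt0.
  have : 0 < lambda1 M * (al4 - al3) * (x1 - th) by rewrite mulr_gt0 ?subr_gt0.
  lra.
apply: decaying_expsum_ge_tangent => //; last by rewrite subr_ge0.
(* The characteristic equation expresses the second derivative at [x1] through values: up to the
   common factor it is [(rho + lambda2) w2 - lambda2 w1]. *)
- have sz (z : R) : is_char_root M z ->
      2^-1 * sigma2 M ^+ 2 * (z ^+ 2 * Phi1 M z) =
      (rho M + lambda2 M) * Phi1 M z - lambda1 M * lambda2 M.
    by rewrite /is_char_root /Phi2 => E; rewrite -[LHS]addr0 -{1}E; ring.
  have ss0 : 0 < 2^-1 * sigma2 M ^+ 2 by rewrite mulr_gt0 ?exprn_gt0 ?invr_gt0.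
  rewrite -(pmulr_rge0 _ ss0).
  rewrite [leRHS](_ : _ =
      (2^-1 * sigma2 M ^+ 2 * (al3 ^+ 2 * Phi1 M al3)) * (al4 * (x1 - th) - 1) +
      (2^-1 * sigma2 M ^+ 2 * (al4 ^+ 2 * Phi1 M al4)) * (1 - al3 * (x1 - th)));
    last by ring.
  rewrite (sz _ hal3) (sz _ hal4).
  rewrite [leRHS](_ : _ = (rho M + lambda2 M) *
      (Phi1 M al3 * (al4 * (x1 - th) - 1) + Phi1 M al4 * (1 - al3 * (x1 - th))) -
      lambda1 M * lambda2 M * (al4 - al3) * (x1 - th)); last by ring.
  (* The affine part of the middle branch cancels, leaving a positive multiple of [P + Q], that is,
     of the second derivative of that branch at [x1]. *)
  rewrite -val [leRHS](_ : _ =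
      (rho M + lambda2 M) * (lambda1 M * (al4 - al3)) * (P + Q)); last first.
    by field; rewrite gt_eqF.
  by rewrite mulr_ge0// mulr_ge0// ltW.
- exact: ltW.
- have : alpha5 M * (P - Q) + lambda2 M / (rho M + lambda2 M) <= 1.
    by rewrite kE; lra.
  by rewrite fit' ler_pdivrMr// mul1r !mulrA.
Qed.

(** * Assembly: regularity, growth and the free-boundary conditions *)

Theorem theorem3p4 (R : realType) (M : model R) (c : R) (f : R -> R)
    (y th al3 al4 x1 x2 : R)
    (rho_gt0 : 0 < rho M)
    (lambda1_gt0 : 0 < lambda1 M) (lambda2_gt0 : 0 < lambda2 M)
    (sigma1_gt0 : 0 < sigma1 M) (sigma12 : sigma1 M < sigma2 M)
    (c_gt0 : 0 < c) (hf : cost_function f)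
    (hy : 0 < y <= 1) (hth : is_theta (rho M) c f y th)
    (hal : 0 < al3 < al4)
    (hal3 : is_char_root M al3) (hal4 : is_char_root M al4)
    (hx : th < x1 < x2)
    (hF1 : F1 M al3 al4 th x1 x2 = 0) (hF2 : F2 M al3 al4 th x1 x2 = 0) :
  let W1 := w1 al3 al4 th x1 in
  let W2 := w2 M al3 al4 th x1 x2 in
  [/\ C1 W1 /\ C1 W2,
      second_derivative_Linfty_loc W1 /\ second_derivative_Linfty_loc W2,
      linear_growth W1 /\ linear_growth W2 &
      free_boundary_problem M th W1 W2 x1 x2].
Proof.
move=> W1 W2.
have sigma2_gt0 := lt_trans sigma1_gt0 sigma12.
have /andP[al3_gt0 al34] := hal; have /andP[thx1 x12] := hx.
have al4_gt0 := lt_trans al3_gt0 al34.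
have thx2 := lt_trans thx1 x12.
have rl0 : 0 < rho M + lambda2 M by rewrite addr_gt0.
have d0 : 0 < al4 - al3 by rewrite subr_gt0.
have ss1 : 0 < 2^-1 * sigma1 M ^+ 2 by rewrite mulr_gt0 ?exprn_gt0 ?invr_gt0.
have ss2 : 0 < 2^-1 * sigma2 M ^+ 2 by rewrite mulr_gt0 ?exprn_gt0 ?invr_gt0.
have g0 := alpha5_gt0 M rho_gt0 lambda2_gt0 sigma2_gt0.
have gE := alpha5_sqr M rho_gt0 lambda2_gt0 sigma2_gt0.
have kE : lambda2 M / (rho M + lambda2 M) = 1 - rho M / (rho M + lambda2 M).
  by field; rewrite gt_eqF.
have [P10 P20] : 0 < Phi1 M al3 /\ Phi1 M al4 < 0.
  have := @char_root_signs R (rho M + lambda1 M) (rho M + lambda2 M)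
    (2^-1 * sigma1 M ^+ 2) (2^-1 * sigma2 M ^+ 2) (lambda1 M * lambda2 M)
    (al3 ^+ 2) (al4 ^+ 2) ss1 ss2.
  rewrite mulr_gt0// ltr_pXn2r ?nnegrE ?ltW// /Phi1.
  have phiE (s r l z : R) : - (2^-1 * s ^+ 2 * z ^+ 2) + r + l =
    r + l - 2^-1 * s ^+ 2 * z ^+ 2 by ring.
  move: hal3 hal4; rewrite /is_char_root /Phi1 /Phi2 !phiE.
  by move=> /eqP + /eqP; rewrite !subr_eq0 => /eqP E3 /eqP E4; apply.
have fit := middle_branch_fit_value _ _ _ _ _ _ rho_gt0 lambda1_gt0 lambda2_gt0
  sigma2_gt0 al34 hF1.
have fit' := middle_branch_fit_slope _ _ _ _ _ _ rho_gt0 lambda1_gt0 lambda2_gt0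
  sigma2_gt0 al34 hF2.
pose lft1 := expsum (A3 al3 al4 th x1) al3 (A4 al3 al4 th x1) al4 0 0.
pose lft2 := expsum (B3 M al3 al4 th x1) al3 (B4 M al3 al4 th x1) al4 0 0.
pose mid := middle_branch M th x2.
pose pay := expsum 0 0 0 0 1 (- th).
have payE x : pay x = x - th by rewrite /pay /expsum; ring.
(* An artificial break point of [W1] at [x2], with equal pieces on both sides, lets the same
   two-point lemma serve for [W1] and [W2]. *)
have W1E : W1 = glue x1 lft1 (glue x2 pay pay).
  apply/funext => x; rewrite /W1 /w1 /glue !payE if_same.
  by case: ifP => // _; rewrite /lft1 /expsum; ring.
have W2E : W2 = glue x1 lft2 (glue x2 mid pay).
  apply/funext => x; rewrite /W2 /w2 /glue !payE.
  case: ifP => [_|_]; first by rewrite /lft2 /expsum; ring.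
  case: ifP => // _; rewrite /mid /middle_branch /expsum mulNr; congr (_ + _).
  by field; rewrite gt_eqF.
have e0 : expR (- 0) = 1 :> R by rewrite oppr0 expR0.
have lft2E x : lft2 x = B3 M al3 al4 th x1 * expR (al3 * x) +
    B4 M al3 al4 th x1 * expR (al4 * x) by rewrite /lft2 /expsum mul0r !addr0.
have lft1E x : lft1 x = A3 al3 al4 th x1 * expR (al3 * x) +
    A4 al3 al4 th x1 * expR (al4 * x) by rewrite /lft1 /expsum mul0r !addr0.
have A3x1 := A3_expR al3 al4 th x1 x1; have A4x1 := A4_expR al3 al4 th x1 x1.
rewrite !subrr !mulr0 e0 !mulr1 in A3x1 A4x1.
have fit_lft2 : lft2 x1 = mid x1.
  rewrite lft2E B3_B4_expR ?gt_eqF// !subrr !mulr0 e0 !mulr1.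
  by rewrite /mid fit.
have x2in : th <= x2 <= x2 by rewrite ltW/=.
have B5x2 : B5 M th x2 * expR (alpha5 M * x2) =
    rho M / (rho M + lambda2 M) / (2 * alpha5 M) * (alpha5 M * (x2 - th) + 1).
  by rewrite B5_expR ?gt_eqF// subrr mulr0 e0 mulr1.
have B6x2 : B6 M th x2 * expR (- alpha5 M * x2) =
    rho M / (rho M + lambda2 M) / (2 * alpha5 M) * (alpha5 M * (x2 - th) - 1).
  by rewrite B6_expR ?gt_eqF// subrr mulr0 expR0 mulr1.
have [C1W1 S1 off1] : [/\ C1 W1, second_derivative_Linfty_loc W1 &
    forall x, x != x1 -> x != x2 -> twice_derivable_at W1 x /\
      derive1n 2 W1 x = glue x1
        (expsum (A3 al3 al4 th x1 * al3 * al3) al3 (A4 al3 al4 th x1 * al4 * al4)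
          al4 0 0) (glue x2 (expsum 0 0 0 0 0 0) (expsum 0 0 0 0 0 0)) x].
  rewrite W1E.
  have := @glue2_C2_off R x1 x2 lft1 pay pay _ _ _ _ _ _ x12
    (is_derive_expsum _ _ _ _ _ _) (is_derive_expsum _ _ _ _ _ _)
    (is_derive_expsum _ _ _ _ _ _) (is_derive_expsum _ _ _ _ _ _)
    (is_derive_expsum _ _ _ _ _ _) (is_derive_expsum _ _ _ _ _ _).
  rewrite !mul0r; apply; try exact: continuous_expsum; try by [].
  - rewrite payE lft1E A3x1 A4x1; field; exact: lt0r_neq0.
  - rewrite /expsum !mul0r !addr0 !add0r [_ * al3 * _]mulrAC [_ * al4 * _]mulrAC.
    rewrite A3x1 A4x1; field; exact: lt0r_neq0.
have [C1W2 S2 off2] : [/\ C1 W2, second_derivative_Linfty_loc W2 &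
    forall x, x != x1 -> x != x2 -> twice_derivable_at W2 x /\
      derive1n 2 W2 x = glue x1
        (expsum (B3 M al3 al4 th x1 * al3 * al3) al3
          (B4 M al3 al4 th x1 * al4 * al4) al4 0 0)
        (glue x2 (expsum (B5 M th x2 * alpha5 M * alpha5 M) (alpha5 M)
          (B6 M th x2 * (- alpha5 M) * (- alpha5 M)) (- alpha5 M) 0 0)
          (expsum 0 0 0 0 0 0)) x].
  rewrite W2E.
  have := @glue2_C2_off R x1 x2 lft2 mid pay _ _ _ _ _ _ x12
    (is_derive_expsum _ _ _ _ _ _) (is_derive_expsum _ _ _ _ _ _)
    (is_derive_expsum _ _ _ _ _ _) (is_derive_expsum _ _ _ _ _ _)
    (is_derive_expsum _ _ _ _ _ _) (is_derive_expsum _ _ _ _ _ _).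
  rewrite !mul0r; apply; try exact: continuous_expsum; try by [].
  (* The value at [x1] is [fit_lft2]. There remain the value at [x2], the slope at [x1], which is
     [fit'], and the slope at [x2]. *)
  - rewrite payE /mid /middle_branch /expsum B5x2 B6x2.
    by field; rewrite !gt_eqF.
  - rewrite /expsum !mul0r !add0r !addr0.
    transitivity (alpha5 M * (B5 M th x2 * expR (alpha5 M * x1)
      - B6 M th x2 * expR (- alpha5 M * x1)) + lambda2 M / (rho M + lambda2 M));
      last by ring.
    rewrite fit' /B3 /B4.
    transitivity (al3 * Phi1 M al3 / lambda1 M *
        (A3 al3 al4 th x1 * expR (al3 * x1)) +
      al4 * Phi1 M al4 / lambda1 M * (A4 al3 al4 th x1 * expR (al4 * x1))).
      by ring.
    by rewrite A3x1 A4x1; field; rewrite !gt_eqF.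
  - rewrite /expsum !mul0r !add0r.
    transitivity (alpha5 M * (B5 M th x2 * expR (alpha5 M * x2)
      - B6 M th x2 * expR (- alpha5 M * x2)) + lambda2 M / (rho M + lambda2 M)).
      by ring.
    by rewrite B5x2 B6x2; field; rewrite !gt_eqF.
have bounds x (h : th <= x <= x2) :=
  middle_branch_bounds M th x2 x rho_gt0 lambda2_gt0 sigma2_gt0 h.
have x1in : th <= x1 <= x2 by rewrite !ltW.
have slope x : th <= x <= x2 ->
    alpha5 M * (B5 M th x2 * expR (alpha5 M * x)
    - B6 M th x2 * expR (- alpha5 M * x)) + lambda2 M / (rho M + lambda2 M) <= 1.
  by move=> /bounds[_ h _]; rewrite kE; move: h; lra.
have key : al3 * al4 * (x1 - th) <= al3 + al4.
  apply: (free_boundary_le (rho M + lambda1 M) (2^-1 * sigma1 M ^+ 2)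
    (lambda1 M)) => //; first by rewrite lerDr ltW.
  by rewrite !addrA -/(Phi1 M al3) -/(Phi1 M al4) -fit' slope.
have W1l x : x <= x1 -> W1 x = lft1 x by move=> h; rewrite W1E glueL.
have W1r x : x1 < x -> W1 x = x - th.
  by move=> h; rewrite W1E glueR// /glue !payE if_same.
have W2l x : x <= x1 -> W2 x = lft2 x by move=> h; rewrite W2E glueL.
have W2m x : x1 < x -> x <= x2 -> W2 x = mid x.
  by move=> h h'; rewrite W2E glueR// glueL.
have W2r x : x2 < x -> W2 x = x - th.
  by move=> h; rewrite W2E glueR ?(lt_trans x12)// glueR.
have zeroE x : expsum 0 0 0 0 0 0 x = 0 :> R by rewrite /expsum; ring.
have contC1 (w : R -> R) : C1 w -> continuous w.
  by move=> [dw _] x; apply/differentiable_continuous/derivable1_diffP.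
have pde1l x : x < x1 -> pde_at (rho M) (lambda1 M) (sigma1 M) W1 W2 x.
  move=> xx1; have xx2 := lt_trans xx1 x12.
  have [tw ddE] := off1 x (negbT (lt_eqF xx1)) (negbT (lt_eqF xx2)).
  split=> //; rewrite /generator ddE glueL ?W1l ?W2l ?ltW//.
  (* The ratios [Phi1 / lambda1] in [B3] and [B4] make the first equation hold exponential by
     exponential. *)
  rewrite lft1E lft2E /expsum /B3 /B4 /Phi1.
  by field; rewrite gt_eqF.
have pde2l x : x < x1 -> pde_at (rho M) (lambda2 M) (sigma2 M) W2 W1 x.
  move=> xx1; have xx2 := lt_trans xx1 x12.
  have [tw ddE] := off2 x (negbT (lt_eqF xx1)) (negbT (lt_eqF xx2)).
  split=> //; rewrite /generator ddE glueL ?W1l ?W2l ?ltW//.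
  rewrite lft1E lft2E /expsum /B3 /B4.
  (* The coefficient of each exponential in the second equation is a multiple of the characteristic
     polynomial at its exponent. *)
  transitivity (- (lambda1 M)^-1 *
    ((Phi1 M al3 * Phi2 M al3 - lambda1 M * lambda2 M) *
       (A3 al3 al4 th x1 * expR (al3 * x)) +
     (Phi1 M al4 * Phi2 M al4 - lambda1 M * lambda2 M) *
       (A4 al3 al4 th x1 * expR (al4 * x)))).
    by rewrite /Phi2; field; rewrite gt_eqF.
  by rewrite hal3 hal4 !mul0r addr0 mulr0.
have pde2m x : x1 < x < x2 -> pde_at (rho M) (lambda2 M) (sigma2 M) W2 W1 x.
  move=> /andP[x1x xx2].
  have [tw ddE] := off2 x (negbT (gt_eqF x1x)) (negbT (lt_eqF xx2)).
  split=> //; rewrite /generator ddE glueR// glueL ?ltW// W1r// W2m ?ltW//.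
  rewrite /mid /middle_branch /expsum.
  (* The affine term is a particular solution, since [W1] is [x - th] here; [alpha5] annihilates the
     homogeneous part. *)
  transitivity ((2^-1 * sigma2 M ^+ 2 * alpha5 M ^+ 2 - (rho M + lambda2 M)) *
    (B5 M th x2 * expR (alpha5 M * x) + B6 M th x2 * expR (- alpha5 M * x))).
    by field; rewrite gt_eqF.
  by rewrite gE subrr mul0r.
have W2pay_r x : x2 < x -> rho M * (x - th) >= 0.
  by move=> h; rewrite mulr_ge0 ?subr_ge0 ?ltW// (lt_trans thx2).
have mid_ge x : x1 <= x <= x2 -> x - th <= mid x.
  move=> /andP[x1x xx2].
  have xin : th <= x <= x2 by rewrite (le_trans (ltW thx1) x1x).
  have [h _ _] := bounds x xin.
  by rewrite /mid /middle_branch /expsum kE; move: h; lra.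
(* The supersolution inequality of [W1] where [W1] is [x - th]. At [x1] the gap is half [sigma1^2]
   times the left second derivative of [W1], nonnegative by [key]; it then grows because [mid] has
   slope at most 1. *)
have mid_le x : x1 <= x <= x2 ->
    lambda1 M * mid x <= (rho M + lambda1 M) * (x - th).
  move=> /andP[x1x xx2]; rewrite -subr_ge0.
  pose phi := expsum (- lambda1 M * B5 M th x2) (alpha5 M)
    (- lambda1 M * B6 M th x2) (- alpha5 M)
    (rho M + lambda1 M - lambda1 M * (lambda2 M / (rho M + lambda2 M)))
    (lambda1 M * (lambda2 M / (rho M + lambda2 M)) * th - (rho M + lambda1 M) * th).
  have phiE z : (rho M + lambda1 M) * (z - th) - lambda1 M * mid z = phi z.
    by rewrite /phi /mid /middle_branch /expsum; ring.
  rewrite phiE; apply: (@le_trans _ _ (phi x1)).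
    rewrite -phiE /mid fit.
    rewrite (_ : _ - _ = 2^-1 * sigma1 M ^+ 2 *
      (al3 + al4 - al3 * al4 * (x1 - th))).
      by rewrite mulr_ge0 ?subr_ge0// ltW.
    by rewrite /Phi1; field; rewrite !gt_eqF.
  apply: ler_expsum => // z /andP[x1z zx].
  have zin : th <= z <= x2 by rewrite (le_trans (ltW thx1) x1z) (le_trans zx).
  have := ler_wpM2l (ltW lambda1_gt0) (slope z zin).
  by rewrite /expsum; move: rho_gt0; lra.
split; [by []|by []| |split].
- split.
    apply: (linear_growth_off W1 x1 x2 _ th (contC1 _ C1W1) _ _) => [x xx1|x x2x].
      by rewrite W1l//;
        exact (expsum_bounded_left _ _ _ _ _ x1 _ (ltW al3_gt0) (ltW al4_gt0) xx1).
    by rewrite W1r// (lt_trans x12).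
  apply: (linear_growth_off W2 x1 x2 _ th (contC1 _ C1W2) _ _) => [x xx1|x x2x].
    by rewrite W2l//;
        exact (expsum_bounded_left _ _ _ _ _ x1 _ (ltW al3_gt0) (ltW al4_gt0) xx1).
  by rewrite W2r.
- by split.
- split=> [x /andP[]|x x2x].
    (* At [x1] itself the formula of the left branch applies, so the claim there is the fit of
       values; likewise at [x2] below. *)
    rewrite le_eqVlt => /predU1P[<- _|x1x _]; last exact: W1r.
    rewrite W1l// lft1E A3x1 A4x1; field; exact: lt0r_neq0.
  rewrite W1r ?(lt_le_trans x12)//; split=> //.
  move: x2x; rewrite le_eqVlt => /predU1P[<-|x2x]; last exact: W2r.
  rewrite W2m// /mid /middle_branch /expsum B5x2 B6x2.
  by field; rewrite !gt_eqF.
- split.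
  + apply: (pde_ineq_ae_off _ _ _ x1 x2) => x xx1 xx2.
    have [tw ddE] := off1 x xx1 xx2; split=> //.
    move: xx1 xx2; rewrite !neq_lt => /orP[xx1 _|x1x].
      by have [_ ->] := pde1l x xx1.
    rewrite /generator ddE glueR// W1r// => /orP[xx2|x2x].
      rewrite glueL ?(ltW xx2)// (W2m _ x1x (ltW xx2)).
      have xin : x1 <= x <= x2 by rewrite !ltW.
      have := mid_le x xin.
      by rewrite zeroE mulr0; lra.
    (* Beyond [x2] both functions equal [x - th], and the generator reduces to [- rho (x - th)]. *)
    rewrite glueR// W2r//; have := W2pay_r x x2x.
    by rewrite zeroE mulr0 subrr mulr0; lra.
  + apply: (pde_ineq_ae_off _ _ _ x1 x2) => x xx1 xx2.
    have [tw ddE] := off2 x xx1 xx2; split=> //.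
    move: xx1 xx2; rewrite !neq_lt => /orP[xx1 _|x1x].
      by have [_ ->] := pde2l x xx1.
    move=> /orP[xx2|x2x].
      by have [|_ ->] := pde2m x; first by rewrite x1x.
    rewrite /generator ddE glueR// glueR// W2r// W1r//.
    by have := W2pay_r x x2x; rewrite zeroE mulr0 subrr mulr0; lra.
  + move=> x; have [xx1|x1x] := leP x x1; last by rewrite W1r.
    by rewrite W1l// lft1E; exact: left_branch1_ge.
  + move=> x; have [xx1|x1x] := leP x x1.
      rewrite W2l// lft2E.
      exact: (left_branch2_ge _ _ _ _ _ x2).
    have [xx2|x2x] := leP x x2; last by rewrite W2r.
    by rewrite W2m// mid_ge// (ltW x1x).
Qed.
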